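(* Let $R$ be a ring, and let $a,b,c\in R$. If $a(ba)^2=abaca=acaba=(ac)^2a$, then the following are equivalent: (1) $ac\in R^{d}$; (2) $ba\in R^{d}$. In this case, $(ac)^{d}=a((ba)^{d})^2c$ and $(ba)^{d}=b((ac)^{d})^2a$.
   Context: All rings are associative with an identity $1$. $U(R)$ denotes the set of units of $R$. For $a\in R$, $comm(a)=\{x\in R : xa=ax\}$ and $comm^2(a)=\{x\in R : xy=yx \text{ for all } y\in comm(a)\}$. $R^{qnil}$ is the set of quasinilpotent elements of $R$, i.e. those $a\in R$ such that $1+xa\in U(R)$ for every $x\in comm(a)$. An element $a\in R$ has a g-Drazin inverse (generalized Drazin inverse) if there exists $b\in R$ such that $b=bab$, $b\in comm^2(a)$ and $a-a^2b\in R^{qnil}$. Such a $b$ is unique if it exists and is denoted $a^d$. $R^{d}$ is the set of all elements of $R$ that have a g-Drazin inverse. *)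

(* Defs.v *)
From mathcomp Require Import all_boot all_algebra.

Set Implicit Arguments.
Unset Strict Implicit.
Unset Printing Implicit Defensive.

Import GRing.Theory.
Local Open Scope ring_scope.

(* [pzRingType] (associative rings with identity, 0 = 1 allowed) carries no
   unit predicate; [GRing.unit] would require a chosen inverse function and
   exclude the zero ring. *)
Definition is_unit (R : pzRingType) (x : R) : Prop :=
  exists y : R, y * x = 1 /\ x * y = 1.

(* [GRing.comm x a] is x * a = a * x, i.e. x belongs to comm(a). *)
Definition comm2 (R : pzRingType) (a x : R) : Prop :=
  forall y : R, GRing.comm y a -> GRing.comm x y.

Definition qnil (R : pzRingType) (a : R) : Prop :=
  forall x : R, GRing.comm x a -> is_unit (1 + x * a).

(* [is_gdrazin a b] reads b = a^d; such a b is unique when it exists. *)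
Definition is_gdrazin (R : pzRingType) (a b : R) : Prop :=
  [/\ b = b * a * b, comm2 a b & qnil (a - a ^+ 2 * b)].

Definition has_gdrazin (R : pzRingType) (a : R) : Prop :=
  exists b : R, is_gdrazin a b.

(* Main.v *)
Require Import Defs.
From mathcomp Require Import all_boot all_algebra.

Set Implicit Arguments.
Unset Strict Implicit.
Unset Printing Implicit Defensive.

Import GRing.Theory.
Local Open Scope ring_scope.

(** The hypotheses say that the four words a?a?a with each ? equal to b or c
    agree.  They imply, for every k >= 3, that (ac)^k a = a (ba)^k and
    b (ac)^k = (ba)^k c, which is the predicate [intertwines] below with s = ac
    and n = ba: next to enough factors, ac and ba can be exchanged across a, and
    b traded for c.

    This makes the classical argument for Cline's formula work.  Let y be the
    g-Drazin inverse of ba.  Since y = (ba)^k y^(k+1) for all k, next to y there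
    are always enough factors to apply the relations; hence ac a y = a ba y and
    y ca = y ba, from which x = a y^2 c satisfies x (ac) = (ac) x = a y c and
    x (ac) x = x.

    For the two remaining conditions, if z commutes with s then b s^k z a
    commutes with n ([comm_transfer]).  For s = ac and n = ba this element
    therefore commutes with y, which gives, after multiplication by suitable
    powers, that z commutes with x ([cline_comm2]).  For quasinilpotence, the
    spectral idempotents 1 - ac x and 1 - ba y cut ac and ba down to elements
    that still satisfy the intertwining relations ([intertwines_spectral]); for
    such a pair quasinilpotence of n gives that of s ([qnil_transfer]).

    The relations are preserved by passing to the opposite ring and exchanging b
    and c, and this exchanges ac and ba; hence the converse implication.  The
    two formulas then follow from the uniqueness of the g-Drazin inverse. *)

(** * Units and quasinilpotent elements *)

(** Jacobson's lemma: formally (1 - yx)^-1 = 1 + y (1 - xy)^-1 x. *)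
Lemma is_unit_jacobson (R : pzRingType) (x y : R) :
  is_unit (1 - x * y) -> is_unit (1 - y * x).
Proof.
case=> d [dl dr]; exists (1 + y * d * x).
have dl' : d = 1 + d * x * y.
  by rewrite -{1}[1]dl mulrBr mulr1 mulrA subrK.
have dr' : d = 1 + x * y * d.
  by rewrite -{1}[1]dr mulrBl mul1r subrK.
split.
  rewrite mulrBr mulr1 mulrDl mul1r.
  rewrite {1}dl' mulrDr mulr1 mulrDl !mulrA.
  by rewrite addrK.
rewrite mulrBl mul1r mulrDr mulr1.
rewrite {1}dr' mulrDr mulr1 mulrDl !mulrA.
by rewrite addrK.
Qed.

Lemma is_unit_subX (R : pzRingType) (t : R) (k : nat) :
  is_unit (1 - t ^+ k) -> is_unit (1 - t).
Proof.
case=> d [dl dr].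
pose S := \sum_(i < k) t ^+ i.
have tS : GRing.comm t S by apply: commr_sum => i _; apply: commrX.
have E : 1 - t ^+ k = (1 - t) * S.
  by rewrite -[LHS]opprB subrX1 -mulNr opprB.
have cS : (1 - t) * S = S * (1 - t) by rewrite mulrBl mulrBr mulr1 mul1r tS.
have eS : d * S = S * d.
  have cE : (1 - t ^+ k) * S = S * (1 - t ^+ k) by rewrite E {1}cS mulrA.
  by rewrite -[d * S]mulr1 -dr mulrA -(mulrA d) -cE mulrA dl mul1r.
exists (d * S); split; first by rewrite -mulrA -cS -E.
by rewrite eS mulrA -E.
Qed.

Lemma idem_unit (R : pzRingType) (g : R) :
  g * g = g -> is_unit (1 - g) -> g = 0.
Proof.
by move=> gg [d [dl _]]; rewrite -[g]mul1r -dl -mulrA mulrBl gg mul1r subrr mulr0.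
Qed.

(** * Elementary properties of the g-Drazin inverse *)

Lemma gdrazin_comm (R : pzRingType) (q y : R) :
  is_gdrazin q y -> y * q = q * y.
Proof. by case=> _ c2 _; apply: c2. Qed.

Lemma gdrazin_powers (R : pzRingType) (q y : R) (k : nat) :
  y * q = q * y -> y = y * q * y -> q ^+ k * y ^+ k.+1 = y.
Proof.
move=> cy ey; elim: k => [|k IH]; first by rewrite mul1r expr1.
by rewrite exprSr -mulrA exprS (exprS y k) !mulrA -(mulrA _ q) -cy
           -(mulrA _ _ y) -ey -mulrA -exprS.
Qed.

Lemma gdrazin_powersD (R : pzRingType) (q y : R) (k j : nat) :
  y * q = q * y -> y = y * q * y -> q ^+ k * y ^+ (k + j.+1) = y ^+ j.+1.
Proof.
move=> cy ey; rewrite addnS -addSn exprD mulrA (gdrazin_powers k cy ey).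
by rewrite -exprS.
Qed.

(** The product ax'(1 - ax) is an idempotent of the form x'n, where
    n = a - a^2 x is quasinilpotent and commutes with x'.  So 1 - x'n is a unit,
    which forces x'n = 0. *)
Lemma gdrazin_idem_absorb (R : pzRingType) (a x x' : R) :
  is_gdrazin a x -> is_gdrazin a x' -> a * x' = a * x' * (a * x).
Proof.
move=> [ex c2 qn] [ex' c2' _].
have cx : GRing.comm x a by apply: c2.
have cx' : GRing.comm x' a by apply: c2'.
have cxx' : GRing.comm x x' by apply: c2.
pose n := a - a ^+ 2 * x.
have cn : GRing.comm x' n.
  by apply/commrB/commrM/commr_sym => //; apply: commrX.
pose e := a * x; pose f := a * x'.
have ee : e * e = e by rewrite /e mulrA -(mulrA _ x a) -mulrA -ex.
have ff : f * f = f by rewrite /f mulrA -(mulrA _ x' a) -mulrA -ex'.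
have ef : e * f = f * e.
  apply: commrM; apply: commr_sym; apply: commrM => //; exact: commr_sym.
have gE : x' * n = f - f * e.
  by rewrite /n mulrBr cx' expr2 !mulrA cx'.
have g0 : x' * n = 0.
  apply: idem_unit; last first.
    rewrite -mulNr; apply: qn.
    by rewrite /GRing.comm mulNr mulrN -/n cn.
  have fef : f * (f * e) = f * e by rewrite mulrA ff.
  have fee : f * e * (f * e) = f * e by rewrite mulrA -(mulrA f e f) ef fef -mulrA ee.
  by rewrite gE mulrBr !mulrBl ff fef fee -mulrA ef fef subrr subr0.
by apply/eqP; rewrite -/f -/e -subr_eq0 -gE g0.
Qed.

Lemma gdrazin_uniq (R : pzRingType) (a x x' : R) :
  is_gdrazin a x -> is_gdrazin a x' -> x = x'.
Proof.
move=> gx gx'; have cx := gdrazin_comm gx; have cx' := gdrazin_comm gx'.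
have e1 := gdrazin_idem_absorb gx gx'; have e2 := gdrazin_idem_absorb gx' gx.
case: gx gx' => ex c2 _ [ex' _ _].
have cxx' : x * x' = x' * x by apply: c2.
have e : a * x = a * x'.
  rewrite e1 [LHS]e2.
  apply: commrM; apply: commr_sym; apply: commrM => //; exact: commr_sym.
by rewrite ex -mulrA e mulrA cx e -cx' -ex'.
Qed.

(** * Elements intertwined by their powers *)

(** The relations of index k between s = ac and n = ba on which the proof rests.
    They are stated for arbitrary s and n because they are needed a second time
    for the quasinilpotent parts of ac and ba. *)
Definition intertwines (R : pzRingType) (a b c s n : R) (k : nat) : Prop :=
  s ^+ k * a = a * n ^+ k /\ b * s ^+ k = n ^+ k * c.

(** Both n w and w n, for w = b s^m z a, reduce to b s^(m+1) z a: the first by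
    trading b s^m for n^m c, the second by moving z to the left of s^m. *)
Lemma comm_transfer (R : pzRingType) (a b c s n z : R) (m : nat) :
  intertwines a b c s n m -> intertwines a b c s n m.+1 ->
  GRing.comm z s -> GRing.comm (b * s ^+ m * z * a) n.
Proof.
move=> [sa bs] [sa1 bs1] zs; rewrite /GRing.comm.
have zX k : z * s ^+ k = s ^+ k * z := commrX k zs.
have -> : n * (b * s ^+ m * z * a) = b * s ^+ m.+1 * z * a.
  by rewrite bs !mulrA -exprS -bs1.
by rewrite -(mulrA b) -zX -!mulrA (mulrA (s ^+ m)) sa -mulrA -exprSr -sa1
           (mulrA z) zX -mulrA.
Qed.

(** For u commuting with s, the element w = b s^m u a commutes with n, so
    1 - w n = 1 - b s^(m+1) u a is a unit; Jacobson's lemma moves a to the front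
    and turns it into 1 - s^(m+2) u.  To reach 1 + z s itself, take
    u = (-z)^(m+2): then s^(m+2) u = t^(m+2) for t = -zs, and 1 - t divides
    1 - t^(m+2). *)
Lemma qnil_transfer (R : pzRingType) (a b c s n : R) (m : nat) :
  intertwines a b c s n m -> intertwines a b c s n m.+1 ->
  a * n ^+ m.+1 * c = s ^+ m.+2 -> qnil n -> qnil s.
Proof.
move=> I0 I1 anc qn z zs.
have unit_u u : GRing.comm u s -> is_unit (1 - s ^+ m.+2 * u).
  move=> us; have wn := comm_transfer I0 I1 us.
  have := qn (- (b * s ^+ m * u * a)); rewrite mulNr wn.
  case: I0 I1 => _ bs [_ bs1].
  rewrite {2}bs !mulrA -exprS -bs1 => Q.
  rewrite -anc -[a * _ * c]mulrA -bs1 -mulrA.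
  apply: is_unit_jacobson; apply: Q.
  by rewrite /GRing.comm mulNr mulrN -!mulrA in wn *; rewrite wn.
have Nzs : GRing.comm (- z) s by rewrite /GRing.comm mulNr mulrN zs.
have uX : GRing.comm ((- z) ^+ m.+2) s by apply/commr_sym/commrX/commr_sym.
rewrite -[z * s]opprK -mulNr; apply: (@is_unit_subX _ _ m.+2).
by rewrite exprMn_comm // (commrX m.+2 uX); apply: unit_u.
Qed.

(** * Cline's formula *)

(** The factor 1 - qy is an idempotent commuting with q. *)
Lemma spectral_powers (R : pzRingType) (q y : R) (k : nat) :
  y * q = q * y -> y = y * q * y ->
  (q - q ^+ 2 * y) ^+ k.+1 = q ^+ k.+1 * (1 - q * y).
Proof.
move=> cy ey; set p := 1 - q * y.
have -> : q - q ^+ 2 * y = q * p by rewrite /p mulrBr mulr1 expr2 mulrA.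
have pp : p * p = p.
  by rewrite /p mulrBl mul1r mulrBr mulr1 mulrA -(mulrA q y) -mulrA -ey subrr subr0.
have qp : GRing.comm q p.
  by apply: commrB; [exact: commr1 | apply: commrM => //; exact: commr_sym].
elim: k => [|k IH]; first by rewrite !expr1.
by rewrite exprS IH -mulrA (mulrA p) (commrX _ (commr_sym qp)) -(mulrA _ p) pp mulrA -exprS.
Qed.

(** Writing y = q^m y^(m+1) provides the power of q across which the relations
    of index m and m + 1 apply. *)
Lemma cline_acay (R : pzRingType) (a b c s q y : R) (m : nat) :
  intertwines a b c s q m -> intertwines a b c s q m.+1 ->
  y * q = q * y -> y = y * q * y -> s * a * y = a * q * y.
Proof.
move=> [sa _] [sa1 _] cy ey.
rewrite -(gdrazin_powers m cy ey) -(mulrA s) !(mulrA a) -sa !mulrA -exprS sa1.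
by rewrite -(mulrA a q) -exprS.
Qed.

Lemma cline_yca (R : pzRingType) (a b c s y : R) (m : nat) :
  intertwines a b c s (b * a) m ->
  y * (b * a) = b * a * y -> y = y * (b * a) * y -> y * c * a = y * (b * a).
Proof.
move=> [sa bs] cy ey.
have yE : y = y ^+ m.+1 * (b * a) ^+ m.
  by rewrite (commrX m (commr_sym (commrX m.+1 (commr_sym cy)))) gdrazin_powers.
rewrite {1}yE -(mulrA _ _ c) -bs -!mulrA sa (mulrA b) -exprS (exprSr (b * a)).
by rewrite mulrA -yE.
Qed.

Lemma cline_left (R : pzRingType) (a b c y : R) (m : nat) :
  intertwines a b c (a * c) (b * a) m -> intertwines a b c (a * c) (b * a) m.+1 ->
  y * (b * a) = b * a * y -> y = y * (b * a) * y ->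
  a * c * (a * y ^+ 2 * c) = a * y * c.
Proof.
move=> I0 I1 cy ey.
rewrite expr2 !mulrA (cline_acay I0 I1 cy ey) -(mulrA a) -cy -(mulrA a) -ey.
by [].
Qed.

Lemma cline_right (R : pzRingType) (a b c y : R) (m : nat) :
  intertwines a b c (a * c) (b * a) m ->
  y * (b * a) = b * a * y -> y = y * (b * a) * y ->
  a * y ^+ 2 * c * (a * c) = a * y * c.
Proof.
move=> I0 cy ey.
have yyca : y ^+ 2 * c * a = y.
  by rewrite expr2 -!mulrA (mulrA y c) (cline_yca I0 cy ey) cy mulrA -ey.
by rewrite mulrA -(mulrA a (y ^+ 2)) -(mulrA a _ a) yyca.
Qed.

(** By [comm_transfer], w = b (ac)^m z a commutes with ba, hence with y.  In
    a (y^(m+3) w) c = a (w y^(m+3)) c the relations produce a factor (ba)^(m+1)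
    on each side; it absorbs all but two factors y, leaving a y^2 c z on the left
    and z a y^2 c on the right. *)
Lemma cline_comm2 (R : pzRingType) (a b c y z : R) (m : nat) :
  intertwines a b c (a * c) (b * a) m -> intertwines a b c (a * c) (b * a) m.+1 ->
  is_gdrazin (b * a) y -> GRing.comm z (a * c) ->
  a * y ^+ 2 * c * z = z * (a * y ^+ 2 * c).
Proof.
move=> I0 I1 gy zs; have cy := gdrazin_comm gy.
have [ey c2 _] := gy.
have yw := commr_sym (commrX (m + 3) (commr_sym (c2 _ (comm_transfer I0 I1 zs)))).
have qy k : (b * a) ^+ k * y ^+ (k + 2) = y ^+ 2.
  exact: gdrazin_powersD cy ey.
have qyC i j : (b * a) ^+ i * y ^+ j = y ^+ j * (b * a) ^+ i.
  by apply: commrX; apply: commr_sym; apply: commrX.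
have zX k : z * (a * c) ^+ k = (a * c) ^+ k * z := commrX k zs.
have [[sa bs] [sa1 bs1]] := (I0, I1).
have E1 : (m + 3)%N = (m.+1 + 2)%N by rewrite addSn -addnS.
have L : a * (y ^+ (m + 3) * (b * (a * c) ^+ m * z * a)) * c = a * y ^+ 2 * c * z.
  have -> : a * (y ^+ (m + 3) * (b * (a * c) ^+ m * z * a)) * c
          = a * (y ^+ (m + 3) * (b * ((a * c) ^+ m * (z * (a * c))))).
    by rewrite !mulrA.
  by rewrite zs (mulrA (_ ^+ m)) -exprSr (mulrA b) bs1 !mulrA -(mulrA a) -qyC E1 qy expr2 !mulrA.
have Rt : a * (b * (a * c) ^+ m * z * a * y ^+ (m + 3)) * c = z * (a * y ^+ 2 * c).
  have -> : a * (b * (a * c) ^+ m * z * a * y ^+ (m + 3)) * c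
          = a * (b * (a * c) ^+ m) * (z * (a * (y ^+ (m + 3) * c))).
    by rewrite !mulrA.
  rewrite bs (mulrA a (_ ^+ m)) -sa -(mulrA _ a) -exprSr mulrA -zX -mulrA (mulrA _ a) sa1.
  by rewrite -(mulrA a) (mulrA (_ ^+ m.+1)) E1 qy expr2 !mulrA.
by rewrite -L -Rt yw.
Qed.

Lemma cline_absorb (R : pzRingType) (a b c y : R) (m : nat) :
  intertwines a b c (a * c) (b * a) m ->
  y * (b * a) = b * a * y -> y = y * (b * a) * y ->
  a * y ^+ 2 * c = a * y ^+ 2 * c * (a * c) * (a * y ^+ 2 * c).
Proof.
move=> I0 cy ey; rewrite (cline_right I0 cy ey).
have ycay : y * c * a * y = y by rewrite (cline_yca I0 cy ey) -ey.
have -> : a * y * c * (a * y ^+ 2 * c) = a * (y * c * a * y) * y * c.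
  by rewrite expr2 !mulrA.
by rewrite ycay expr2 !mulrA.
Qed.

(** With p = 1 - ac x = 1 - a y c and r = 1 - ba y, the relations for the cut-down
    elements (ac) p and (ba) r reduce to p a = a r and (ba)^k c p = (ba)^k r c. *)
Lemma intertwines_spectral (R : pzRingType) (a b c y : R) (m k : nat) :
  intertwines a b c (a * c) (b * a) m -> intertwines a b c (a * c) (b * a) m.+1 ->
  intertwines a b c (a * c) (b * a) k.+1 ->
  y * (b * a) = b * a * y -> y = y * (b * a) * y ->
  intertwines a b c (a * c - (a * c) ^+ 2 * (a * y ^+ 2 * c))
    (b * a - (b * a) ^+ 2 * y) k.+1.
Proof.
move=> I0 I1 [sa bs] cy ey.
have sx := cline_left I0 I1 cy ey; have xs := cline_right I0 cy ey.
have cx : a * y ^+ 2 * c * (a * c) = a * c * (a * y ^+ 2 * c) by rewrite xs sx.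
rewrite /intertwines (spectral_powers k cy ey).
rewrite (spectral_powers k cx (cline_absorb I0 cy ey)) sx; split.
  have -> : (a * c) ^+ k.+1 * (1 - a * y * c) * a
          = (a * c) ^+ k.+1 * a * (1 - y * c * a).
    by rewrite -!mulrA; congr (_ * _); rewrite mulrBl mulrBr mul1r mulr1 !mulrA.
  by rewrite (cline_yca I0 cy ey) cy sa -!mulrA.
have qca : (b * a) ^+ k.+1 * c * a = (b * a) ^+ k.+1 * (b * a).
  by rewrite -bs -mulrA sa mulrA -exprS exprSr.
rewrite mulrA bs mulrBr mulr1 mulrBr mulrBl mulr1; congr (_ - _).
by rewrite !mulrA qca !mulrA.
Qed.

Lemma cline_gdrazin (R : pzRingType) (a b c y : R) (m : nat) :
  intertwines a b c (a * c) (b * a) m.+1 ->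
  intertwines a b c (a * c) (b * a) m.+2 ->
  is_gdrazin (b * a) y -> is_gdrazin (a * c) (a * y ^+ 2 * c).
Proof.
move=> I0 I1 gy; have cy := gdrazin_comm gy; have [ey _ qn] := gy.
split; first exact: (cline_absorb I0 cy ey).
  by move=> z zs; apply: (cline_comm2 I0 I1 gy).
have T0 := intertwines_spectral I0 I1 I0 cy ey.
have T1 := intertwines_spectral I0 I1 I1 cy ey.
apply: (qnil_transfer T0 T1) qn; case: T1 => <- _.
have sx := cline_left I0 I1 cy ey; have xs := cline_right I0 cy ey.
have cx : a * y ^+ 2 * c * (a * c) = a * c * (a * y ^+ 2 * c) by rewrite xs sx.
have cp : GRing.comm (a * c) (1 - a * c * (a * y ^+ 2 * c)).
  by apply: commrB; [exact: commr1 | apply: commrM => //; exact: commr_sym].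
rewrite -mulrA !(spectral_powers _ cx (cline_absorb I0 cy ey)).
by rewrite [in RHS](exprSr (a * c)) -!(mulrA (_ ^+ _)) cp.
Qed.

(** * Exchange of ac and ba *)

Lemma exprC (R : pzRingType) (x : R) (k : nat) : (x : R^c) ^+ k = x ^+ k.
Proof. by elim: k => // k IH; rewrite exprS exprSr IH. Qed.

Lemma intertwinesC (R : pzRingType) (a b c s n : R) (k : nat) :
  intertwines a b c s n k -> @intertwines R^c a c b n s k.
Proof. by case=> sa bs; split; rewrite !exprC. Qed.

Lemma commC (R : pzRingType) (x y : R) : @GRing.comm R^c x y <-> GRing.comm x y.
Proof. by split=> h; apply: esym. Qed.

(** Every clause of the definition is symmetric, up to the commutation of x and
    of the test elements with a or with its quasinilpotent part. *)
Lemma gdrazinC (R : pzRingType) (a x : R) :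
  is_gdrazin a x -> @is_gdrazin R^c a x.
Proof.
move=> gx; have cx := gdrazin_comm gx; case: gx => ex c2 qn; split.
- by rewrite [LHS]ex -[LHS]mulrA.
- by move=> z /commC /c2 /commC.
rewrite -(commrX 2 cx) in qn.
by move=> z /commC zn; have := qn z zn; rewrite zn => -[d [dl dr]]; exists d.
Qed.

(** The case k = 2 of the first relation is a hypothesis, and acaba = ababa
    carries it to higher powers.  The second relation needs index 3, since it is
    obtained from the first by multiplying by b on the left and c on the right. *)
Lemma words_intertwine (R : pzRingType) (a b c : R) (k : nat) :
  a * (b * a) ^+ 2 = a * c * a * b * a ->
  a * c * a * b * a = (a * c) ^+ 2 * a ->
  intertwines a b c (a * c) (b * a) k.+3.
Proof.
move=> acaba acaca.
have shift j : (a * c) ^+ j.+2 * a = a * (b * a) ^+ j.+2.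
  elim: j => [|j IH]; first by rewrite acaba acaca.
  rewrite exprS -mulrA IH (exprS _ j.+1) (mulrA (a * c)) mulrA.
  have -> : a * c * a * (b * a) = a * (b * a) ^+ 2 by rewrite acaba mulrA.
  by rewrite -mulrA -exprD.
split; first exact: shift.
by rewrite exprSr (mulrA _ a c) shift !(mulrA b) -exprS.
Qed.

Theorem theorem2p2 (R : pzRingType) (a b c : R)
  (h1 : a * (b * a) ^+ 2 = a * b * a * c * a)
  (h2 : a * b * a * c * a = a * c * a * b * a)
  (h3 : a * c * a * b * a = (a * c) ^+ 2 * a) :
  (has_gdrazin (a * c) <-> has_gdrazin (b * a)) /\
  (forall x y : R, is_gdrazin (a * c) x -> is_gdrazin (b * a) y ->
     x = a * y ^+ 2 * c /\ y = b * x ^+ 2 * a).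
Proof.
have acaba : a * (b * a) ^+ 2 = a * c * a * b * a by rewrite h1 h2.
have I0 := words_intertwine 0 acaba h3; have I1 := words_intertwine 1 acaba h3.
have ba_ac y : is_gdrazin (b * a) y -> is_gdrazin (a * c) (a * y ^+ 2 * c).
  exact: (cline_gdrazin I0 I1).
have ac_ba x : is_gdrazin (a * c) x -> is_gdrazin (b * a) (b * x ^+ 2 * a).
  move=> /gdrazinC gx; apply: (@gdrazinC R^c).
  have := @cline_gdrazin R^c a c b x 2 (intertwinesC I0) (intertwinesC I1) gx.
  by rewrite exprC -mulrA.
split; first by split=> -[d gd]; [exists (b * d ^+ 2 * a) | exists (a * d ^+ 2 * c)]; auto.
by move=> x y gx gy; split; [apply: gdrazin_uniq gx _ | apply: gdrazin_uniq gy _]; auto.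
Qed.
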